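(* Let $X$ be a real Hilbert space, let $A, B : X \rightrightarrows X$ be maximally monotone, let $w \in X$, $\gamma \in \,]0,1[$ and $\lambda \in \,]0,1]$. Then \begin{align*} R_{B_\gamma} R_{A_\gamma} &= \mathrm{Id} + 2 J_{B_\gamma} R_{A_\gamma} - 2 J_{A_\gamma} \\ &= \mathrm{Id} + 2\gamma J_B R_{A_\gamma} - 2\gamma J_A \\ &= T_{A,B} + (1-2\gamma) J_A - J_B R_A + 2\gamma J_B R_{A_\gamma}, \end{align*} and \begin{align*} R_{A_\gamma} R_{B_\gamma} &= \mathrm{Id} + 2 J_{A_\gamma} R_{B_\gamma} - 2 J_{B_\gamma} \\ &= \mathrm{Id} + 2\gamma J_A R_{B_\gamma} - 2\gamma J_B \\ &= T_{B,A} + (1-2\gamma) J_B - J_A R_B + 2\gamma J_A R_{B_\gamma}. \end{align*} Moreover, \begin{align*} T_{A_\gamma,B_\gamma} &= \mathrm{Id} + 2\lambda J_{B_\gamma} R_{A_\gamma} - 2\lambda J_{A_\gamma} \\ &= \mathrm{Id} + 2\lambda\gamma J_B R_{A_\gamma} - 2\lambda\gamma J_A \\ &= \mathrm{Id} + 2\lambda\gamma\,( J_B R_{A_\gamma} - J_A ) \\ &= T_{A,B} + (1 - 2\lambda\gamma) J_A - J_B R_A + 2\lambda\gamma J_B R_{A_\gamma} \\ &= T_{B,A} + J_B - J_A R_B + 2\lambda\gamma J_B R_{A_\gamma} - 2\lambda\gamma J_A, \end{align*} and \begin{align*} T_{B_\gamma,A_\gamma} &= \mathrm{Id} + 2\lambda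 J_{A_\gamma} R_{B_\gamma} - 2\lambda J_{B_\gamma} \\ &= \mathrm{Id} + 2\lambda\gamma J_A R_{B_\gamma} - 2\lambda\gamma J_B \\ &= \mathrm{Id} + 2\lambda\gamma\,( J_A R_{B_\gamma} - J_B ) \\ &= T_{B,A} + (1 - 2\lambda\gamma) J_B - J_A R_B + 2\lambda\gamma J_A R_{B_\gamma}. \end{align*}
   Context: For a maximally monotone operator $C : X \rightrightarrows X$, the resolvent is $J_C = (\mathrm{Id} + C)^{-1}$ (a single-valued map on all of $X$) and the reflected resolvent is $R_C = 2J_C - \mathrm{Id}$. Juxtaposition of maps denotes composition; sums and scalar multiples of maps are pointwise. For $C \in \{A,B\}$, the operator $C_\gamma : X \rightrightarrows X$ is defined by $$C_\gamma(x) = C\big(\gamma^{-1}(x - (1-\gamma)w)\big) + \gamma^{-1}(1-\gamma)(x - w).$$ It is known that $C_\gamma$ is maximally monotone, with $J_{C_\gamma} = \gamma J_C + (1-\gamma)w$ and $R_{C_\gamma} = 2\gamma J_C + 2(1-\gamma)w - \mathrm{Id}$. The Aragón Artacho–Campoy operators are $T_{A_\gamma,B_\gamma} = (1-\lambda)\mathrm{Id} + \lambda R_{B_\gamma} R_{A_\gamma}$ and $T_{B_\gamma,A_\gamma} = (1-\lambda)\mathrm{Id} + \lambda R_{A_\gamma} R_{B_\gamma}$. The Douglas–Rachford operators are $T_{A,B} = \frac12(\mathrm{Id} + R_B R_A)= \mathrm{Id} - J_A + J_B R_A$ and $T_{B,A} = \frac12(\mathrm{Id} + R_A R_B) = \mathrm{Id}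 - J_B + J_A R_B$ (these do not involve $\lambda$). *)

(* Defs.v *)
From mathcomp Require Import all_boot all_order all_algebra sesquilinear.
From mathcomp Require Import all_classical all_reals all_analysis.

Set Implicit Arguments.
Unset Strict Implicit.
Unset Printing Implicit Defensive.

Import Order.TTheory GRing.Theory Num.Theory.
Import numFieldNormedType.Exports.

Local Open Scope classical_set_scope.
Local Open Scope ring_scope.

(* With [X : completeNormedModType R], this makes X a real Hilbert space: the
   positive definite symmetric bilinear form [dot] induces the norm of X. *)
Definition dot_induces_norm (R : realType) (X : normedModType R)
    (dot : {dot X for idfun}) : Prop :=
  forall x : X, `|x| ^+ 2 = dot x x.

(* A set-valued operator X ⇉ X is a function [A : X -> set X]; [A x u] says
   that (x, u) belongs to the graph of A. *)
Definition monotone_op (R : realType) (X : normedModType R)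
    (dot : {dot X for idfun}) (A : X -> set X) : Prop :=
  forall x y u v : X, A x u -> A y v -> 0 <= dot (x - y) (u - v).

Definition maximally_monotone (R : realType) (X : normedModType R)
    (dot : {dot X for idfun}) (A : X -> set X) : Prop :=
  monotone_op dot A /\
  forall B : X -> set X, monotone_op dot B ->
    (forall x, A x `<=` B x) -> B = A.

Section Operators.
Context {R : realType} {X : normedModType R}.
Implicit Types (A B C : X -> set X) (w x : X) (gamma lambda : R).

Definition op_id : X -> set X := fun x => [set x].

Definition op_add A B : X -> set X :=
  fun x => [set u + v | u in A x & v in B x].

Definition op_inv A : X -> set X := fun u => [set x | A x u].

(* The single-valued map whose graph is that of (Id + C)^-1. By Minty's theorem
   (Id + C)^-1 is single-valued and everywhere defined when C is maximally
   monotone, so the default value 0 is then never used. *)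
Definition resolvent C : X -> X :=
  fun x => xget 0 (op_inv (op_add op_id C) x).

Definition reflected_resolvent C : X -> X := 2 *: resolvent C - idfun.

Definition op_gamma gamma w C : X -> set X :=
  fun x => [set u + (gamma^-1 * (1 - gamma)) *: (x - w)
           | u in C (gamma^-1 *: (x - (1 - gamma) *: w))].

Definition douglas_rachford A B : X -> X :=
  2^-1 *: (idfun + (reflected_resolvent B \o reflected_resolvent A)).

(* The Aragón Artacho–Campoy operator T_{A_gamma,B_gamma}; [Agamma] and
   [Bgamma] stand for the operators already transformed by [op_gamma]. *)
Definition aragon_campoy lambda Agamma Bgamma : X -> X :=
  (1 - lambda) *: idfun
  + lambda *: (reflected_resolvent Bgamma \o reflected_resolvent Agamma).

End Operators.

(* Main.v *)
(* A resolvent is a choice operator with default value 0, so the identity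
   J_(C_gamma) = gamma J_C + (1 - gamma) w really needs Minty's theorem. It is
   obtained from the Fitzpatrick function F of A: minimising the strongly convex
   function F(x, u) + (|x|^2 + |u|^2) / 2, whose minimising sequences are Cauchy
   by the parallelogram law, gives a point (x, u) such that (-u, -x) is
   monotonically related to A. By maximality (-u, -x) is in the graph, which
   forces u = -x and 0 in x + A x; translating A gives surjectivity of Id + A.
   The identities are then linear algebra at each point, checked after pairing
   with an arbitrary vector so that they become identities in R. *)
Require Import Defs.
From mathcomp Require Import all_boot all_order all_algebra sesquilinear.
From mathcomp Require Import all_classical all_reals all_analysis.
From mathcomp Require Import ring lra.

Set Implicit Arguments.
Unset Strict Implicit.
Unset Printing Implicit Defensive.

Import Order.TTheory GRing.Theory Num.Theory.
Import numFieldNormedType.Exports.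

Local Open Scope classical_set_scope.
Local Open Scope ring_scope.

(* The values of a [{dot X for idfun}] live in the underlying [numDomainType];
   retyping them in [R] gives [lra] and [field] a single ring structure. *)
Definition inner (R : realType) (X : normedModType R) (dot : {dot X for idfun})
  (x y : X) : R := dot x y.

(** * Calculus of the inner product, and its continuity *)

Section DotProduct.
Variables (R : realType) (X : normedModType R) (dot : {dot X for idfun}).
Implicit Types x y z : X.

Lemma innerC x y : inner dot x y = inner dot y x.
Proof. by rewrite /inner (@hermC _ _ _ _ dot) expr0 mul1r. Qed.

Lemma innerDl x y z : inner dot (x + y) z = inner dot x z + inner dot y z.
Proof. exact: linearDl. Qed.

Lemma innerZl (a : R) x z : inner dot (a *: x) z = a * inner dot x z.
Proof. exact: linearZl_LR. Qed.

Lemma innerNl x z : inner dot (- x) z = - inner dot x z.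
Proof. exact: linearNl. Qed.

Lemma innerDr x y z : inner dot z (x + y) = inner dot z x + inner dot z y.
Proof. by rewrite innerC innerDl !(innerC z). Qed.

Lemma innerZr (a : R) x z : inner dot z (a *: x) = a * inner dot z x.
Proof. by rewrite innerC innerZl !(innerC z). Qed.

Lemma innerNr x z : inner dot z (- x) = - inner dot z x.
Proof. by rewrite innerC innerNl !(innerC z). Qed.

Definition innerE := (innerDl, innerDr, innerNl, innerNr, innerZl, innerZr).

Lemma monotone_inner (A : X -> set X) x y u v : monotone_op dot A ->
  A x u -> A y v -> 0 <= inner dot (x - y) (u - v).
Proof. by move=> monA; exact: monA. Qed.

Hypothesis hdot : dot_induces_norm dot.

Lemma inner_norm x : inner dot x x = `|x| ^+ 2.
Proof. by rewrite hdot. Qed.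

Lemma inner_ge0 x : 0 <= inner dot x x.
Proof. by rewrite inner_norm exprn_ge0. Qed.

Lemma inner_eq0 x : inner dot x x <= 0 -> x = 0.
Proof.
rewrite inner_norm => x_le0; apply/eqP; rewrite -normr_eq0 -sqrf_eq0.
by rewrite eq_le x_le0 exprn_ge0.
Qed.

Lemma inner_inj x y : (forall z, inner dot x z = inner dot y z) -> x = y.
Proof.
move=> xy; apply/eqP; rewrite -subr_eq0; apply/eqP/inner_eq0.
by rewrite innerDl innerNl xy subrr.
Qed.

Lemma cvg_innerxx (f : nat -> X) x :
  f n @[n --> \oo] --> x -> inner dot (f n) (f n) @[n --> \oo] --> inner dot x x.
Proof.
move=> fx; rewrite inner_norm expr2; under eq_fun do rewrite inner_norm expr2.
by apply: cvgM; apply: cvg_norm.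
Qed.

(** Polarization reduces this to the continuity of the norm. *)
Lemma cvg_innerl (f : nat -> X) x z :
  f n @[n --> \oo] --> x -> inner dot (f n) z @[n --> \oo] --> inner dot x z.
Proof.
move=> fx.
have polar y : inner dot y z
    = 4^-1 * (inner dot (y + z) (y + z) - inner dot (y - z) (y - z)).
  by rewrite !innerE (innerC z y); field.
rewrite polar; under eq_fun do rewrite polar.
apply: cvgM; first exact: cvg_cst.
by apply: cvgB; apply: cvg_innerxx;
  [apply: cvgD => //; exact: cvg_cst | apply: cvgB => //; exact: cvg_cst].
Qed.

End DotProduct.

(** * Minimisation of a convex function plus half the squared norm *)

Section QuadraticMinimizer.
Variables (R : realType) (X : completeNormedModType R).
Variables (dot : {dot X for idfun}) (hdot : dot_induces_norm dot).

Lemma cvg_of_small_sqr_dist (f : nat -> X) (c : R) :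
  (forall n k, inner dot (f n - f k) (f n - f k)
    <= c * (n.+1%:R^-1 + k.+1%:R^-1)) ->
  cvg (f n @[n --> \oo]).
Proof.
move=> fc; apply/cauchy_cvgP/cauchy_ballP => e e0.
have inv0 : (c * n.+1%:R^-1 : R) @[n --> \oo] --> c * 0.
  by apply: cvgM; [exact: cvg_cst | exact: cvg_harmonic].
rewrite mulr0 in inv0.
have e2 : 0 < e ^+ 2 / 2 by rewrite divr_gt0// exprn_gt0.
have H := cvgr_lt _ inv0 _ e2.
(* A tail of the sequence: any two of its indices give a squared distance below [e ^+ 2]. *)
pose small := f @` [set n | c * n.+1%:R^-1 < e ^+ 2 / 2].
exists (small, small) => [|_ [[n /= hn <-] [k /= hk <-]]].
  have fsmall : \forall n \near \oo, small (f n).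
    by near=> n; exists n => //=; near: n; exact: H.
  by split; exact: fsmall.
rewrite -ball_normE /= -(@ltr_pXn2r _ 2)// ?nnegrE ?(ltW e0)//.
rewrite -(inner_norm hdot); apply: le_lt_trans (fc n k) _.
by rewrite mulrDr (splitr (e ^+ 2)) ltrD.
Unshelve. all: by end_near. Qed.

(** [E] is to be read as the epigraph of a function of the pair [(x, u)], with [t] the height. *)
Variable E : X -> X -> R -> Prop.

Let phi x u (t : R) : R := t + 2^-1 * (inner dot x x + inner dot u u).

Hypothesis E_nonempty : exists x u t, E x u t.
Hypothesis E_midpoint : forall x u t x' u' t', E x u t -> E x' u' t' ->
  E (2^-1 *: (x + x')) (2^-1 *: (u + u')) (2^-1 * (t + t')).
Hypothesis E_closed : forall (f g : nat -> X) (h : nat -> R) x u t,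
  (forall n, E (f n) (g n) (h n)) ->
  f n @[n --> \oo] --> x -> g n @[n --> \oo] --> u ->
  h n @[n --> \oo] --> t -> E x u t.
Hypothesis phi_ge0 : forall x u t, E x u t -> 0 <= phi x u t.

Lemma quadratic_minimizer : exists x u t, E x u t /\
  forall x' u' t', E x' u' t' -> phi x u t <= phi x' u' t'.
Proof.
pose S := [set r : R | exists x u t, E x u t /\ r = phi x u t].
have lbS : lbound S 0 by move=> _ [x [u [t [Ext ->]]]]; exact: phi_ge0.
have infS : has_inf S.
  split; last by exists 0.
  by have [x [u [t Ext]]] := E_nonempty; exists (phi x u t), x, u, t.
pose m := inf S.
have phi_ge x u t : E x u t -> m <= phi x u t.
  by move=> Ext; apply: ge_inf; [exists 0 | exists x, u, t].
have /choice [p Hp] (n : nat) : exists p : X * X * R,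
    E p.1.1 p.1.2 p.2 /\ phi p.1.1 p.1.2 p.2 < m + n.+1%:R^-1.
  have [|r [x [u [t [Ext ->]]]] lt_r] := @inf_adherent _ S n.+1%:R^-1 _ infS.
    by rewrite invr_gt0.
  by exists (x, u, t).
pose f n := (p n).1.1; pose g n := (p n).1.2; pose h n := (p n).2.
have fgh n : E (f n) (g n) (h n) by have [] := Hp n.
have fgh_lt n : phi (f n) (g n) (h n) < m + n.+1%:R^-1 by have [] := Hp n.
(* By the parallelogram law, [phi] at the midpoint is the mean of the two values minus an eighth of
   this squared distance, and it is at least [m]; hence the constant 4. *)
have dist n k :
    inner dot (f n - f k) (f n - f k) + inner dot (g n - g k) (g n - g k)
    <= 4 * (n.+1%:R^-1 + k.+1%:R^-1).
  have := phi_ge _ _ _ (E_midpoint (fgh n) (fgh k)).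
  have := fgh_lt n; have := fgh_lt k; rewrite /phi !innerE.
  rewrite (innerC dot (f k) (f n)) (innerC dot (g k) (g n)).
  set a := n.+1%:R^-1; set b := k.+1%:R^-1; clearbody a b.
  by lra.
have /cvg_ex[/= x fx] : cvg (f n @[n --> \oo]).
  apply: (@cvg_of_small_sqr_dist _ 4) => n k.
  by apply: le_trans (dist n k); rewrite lerDl inner_ge0.
have /cvg_ex[/= u gu] : cvg (g n @[n --> \oo]).
  apply: (@cvg_of_small_sqr_dist _ 4) => n k.
  by apply: le_trans (dist n k); rewrite lerDr inner_ge0.
have phi_m : phi (f n) (g n) (h n) @[n --> \oo] --> m.
  apply: (@squeeze_cvgr _ _ _ _ (cst m) (fun n => m + n.+1%:R^-1)).
  - by apply: nearW => n; rewrite phi_ge// ltW.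
  - exact: cvg_cst.
  rewrite -[X in _ --> X]addr0; apply: cvgD; first exact: cvg_cst.
  exact: cvg_harmonic.
(* This height makes [phi] equal to [m]; it is the limit of [h], since [phi] tends to [m] along the
   sequence. *)
exists x, u, (m - 2^-1 * (inner dot x x + inner dot u u)); split; last first.
  by move=> x' u' t' /phi_ge; rewrite /phi; lra.
apply: (E_closed fgh fx gu).
have -> : h = fun n => phi (f n) (g n) (h n)
    - 2^-1 * (inner dot (f n) (f n) + inner dot (g n) (g n)).
  by apply/funext => n; rewrite /phi; ring.
apply: cvgB => //; apply: cvgM; first exact: cvg_cst.
by apply: cvgD; exact: cvg_innerxx.
Qed.

End QuadraticMinimizer.

(** * Minty's theorem and the resolvent of [op_gamma] *)

Section Minty.
Variables (R : realType) (X : completeNormedModType R).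
Variables (dot : {dot X for idfun}) (hdot : dot_induces_norm dot).
Implicit Types A : X -> set X.

(** Adding the pair [(x, u)] to the graph keeps it monotone, so maximality puts it there already. *)
Lemma maximally_monotone_mem A x u : maximally_monotone dot A ->
  (forall y v, A y v -> 0 <= inner dot (x - y) (u - v)) -> A x u.
Proof.
move=> [monA maxA] xu; pose B y := A y `|` [set v | y = x /\ v = u].
have <- : B = A; last by right.
apply: maxA => [y z v s [Ayv|[-> ->]] [Azs|[-> ->]]|y v Ayv]; last by left.
- exact: monA.
- rewrite -/(inner dot _ _) -(opprB x) -(opprB u) innerNl innerNr opprK.
  exact: xu.
- exact: xu.
- by rewrite subrr linear0l.
Qed.

(* The epigraph avoids the value +oo of the Fitzpatrick function. *)
Let fitzpatrick_epi A x u (t : R) :=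
  forall y v, A y v -> inner dot x v + inner dot y u - inner dot y v <= t.

Lemma maximally_monotone_translate A z : maximally_monotone dot A ->
  maximally_monotone dot (fun x => [set u | A x (u + z)]).
Proof.
move=> maxA; split=> [x y u v Ax Ay|B monB AB].
  by have := maxA.1 _ _ _ _ Ax Ay; rewrite opprD addrACA subrr addr0.
apply/funext => x; apply/seteqP; split => [u Bu|]; last exact: AB.
apply: maximally_monotone_mem => // y v Ayv.
rewrite -addrA -(opprB v z); apply: monotone_inner monB Bu _.
by apply: AB; rewrite /= subrK.
Qed.

Lemma minty_zero A :
  maximally_monotone dot A -> exists x, A x (- x).
Proof.
move=> maxA; have [monA _] := maxA.
pose E := fitzpatrick_epi A.
have E_graph y v : A y v -> E y v (inner dot y v).
  move=> Ayv y' v' Ayv'; have := monotone_inner monA Ayv Ayv'.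
  by rewrite !innerE; lra.
(* If [t] were smaller, [Ext] would make [(x, u)] monotonically related to [A], hence in the graph;
   [Ext] at [(x, u)] itself then contradicts this. *)
have E_ge x u t : E x u t -> inner dot x u <= t.
  move=> Ext; rewrite leNgt; apply/negP => tlt.
  have /Ext : A x u; last by rewrite addrK leNgt tlt.
  apply: maximally_monotone_mem => // y v /Ext.
  by rewrite !innerE; lra.
have [||||x [u [t [Ext min]]]] := @quadratic_minimizer _ _ _ hdot E.
(* With an empty graph, [(0, 0)] would be vacuously related to [A], hence in it. *)
- have [y [v Ayv]] : exists y v, A y v.
    apply: contrapT => /forallNP A0; apply: (A0 0); exists 0.
    by apply: maximally_monotone_mem => // y v Ayv; case: (A0 y); exists v.
  by exists y, v, (inner dot y v); exact: E_graph.
- move=> x u t x' u' t' Ext Ext' y v Ayv.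
  by have := Ext _ _ Ayv; have := Ext' _ _ Ayv; rewrite !innerE; lra.
- move=> f g h x u t Efgh fx gu ht y v Ayv.
  have lhs : inner dot (f n) v + inner dot y (g n) - inner dot y v @[n --> \oo]
      --> inner dot x v + inner dot y u - inner dot y v.
    apply: cvgB; last exact: cvg_cst.
    apply: cvgD; first exact: cvg_innerl.
    by rewrite innerC; under eq_fun do rewrite innerC; exact: cvg_innerl.
  apply: (ler_cvg_to lhs ht); apply: nearW => n; exact: Efgh.
- move=> x u t /E_ge xut; have := inner_ge0 hdot (x + u).
  by rewrite !innerE (innerC dot u x); lra.
have variational y v : A y v ->
    inner dot (x + u) (x + u) <= inner dot (- u - y) (- x - v).
  (* [d] is the directional derivative of the objective at the minimiser towards
     [(y, v, inner dot y v)]; its nonnegativity and [E_ge] give the bound. *)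
  move=> Ayv; pose d :=
    inner dot y v - t + inner dot x (y - x) + inner dot u (v - u).
  suff : 0 <= d.
    have := E_ge _ _ _ Ext; rewrite /d !innerE.
    by rewrite (innerC dot u x) (innerC dot y x); lra.
  pose q := 2^-1 * (inner dot (y - x) (y - x) + inner dot (v - u) (v - u)).
  (* Moving by [s] along the segment changes the objective by [s * (d + s * q)]. *)
  have small s : 0 < s <= 1 -> 0 <= d + s * q.
    move=> /andP[s0 s1].
    have Es : E (x + s *: (y - x)) (u + s *: (v - u))
                (t + s * (inner dot y v - t)).
      move=> y' v' Ayv'; have s1' : 0 <= 1 - s by rewrite subr_ge0.
      have := lerD (ler_wpM2l s1' (Ext _ _ Ayv'))
                   (ler_wpM2l (ltW s0) (E_graph _ _ Ayv _ _ Ayv')).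
      by rewrite !innerE; lra.
    have := min _ _ _ Es; rewrite -(pmulr_rge0 _ s0) -subr_ge0.
    congr (0 <= _); rewrite /d /q !innerE (innerC dot y x) (innerC dot v u).
    by field.
  have q0 : 0 <= q by rewrite mulr_ge0 ?addr_ge0 ?inner_ge0.
  apply/ler_addgt0Pr => e e0; have eq0 : 0 < e + q by rewrite ltr_wpDr.
  (* This step lies in []0, 1]] and satisfies [s * q <= e]. *)
  apply: le_trans (small (e / (e + q)) _) _.
    by rewrite divr_gt0//= ler_pdivrMr// mul1r lerDl.
  rewrite lerD2l -mulrA ler_piMr ?(ltW e0)// mulrC ler_pdivrMr//.
  by rewrite mul1r lerDr ltW.
have Aux : A (- u) (- x).
  apply: maximally_monotone_mem => // y v /variational.
  exact/le_trans/inner_ge0.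
(* Taking [(- u, - x)] itself as the graph point makes the right side of [variational] vanish. *)
have /inner_eq0 : inner dot (x + u) (x + u) <= 0.
  by have := variational _ _ Aux; rewrite !subrr {2}/inner linear0l.
by move=> /(_ hdot)/eqP; rewrite addr_eq0 => /eqP xu; exists x; rewrite {1}xu.
Qed.

Theorem minty A z : maximally_monotone dot A -> exists x, A x (z - x).
Proof.
move=> /(maximally_monotone_translate z)/minty_zero[x Ax].
by exists x; rewrite addrC.
Qed.

(** For two solutions [x] and [y], monotonicity gives [0 <= - inner dot (x - y) (x - y)]. *)
Lemma resolventE A z x : monotone_op dot A -> A x (z - x) -> resolvent A z = x.
Proof.
move=> monA Ax; apply: xget_unique.
  by exists x => //; exists (z - x) => //; rewrite addrC subrK.
move=> y [_ -> [v Ayv yvz]].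
apply/eqP; rewrite -subr_eq0; apply/eqP; apply: (inner_eq0 hdot).
have := monotone_inner monA Ax Ayv.
have -> : v = z - y by rewrite -yvz addrC addKr.
by rewrite !innerE (innerC dot x y); lra.
Qed.

Lemma resolvent_graph A z : maximally_monotone dot A ->
  A (resolvent A z) (z - resolvent A z).
Proof.
by move=> maxA; have [x Ax] := minty z maxA; rewrite (resolventE maxA.1 Ax).
Qed.

Lemma op_gamma_monotone gamma w A : 0 < gamma < 1 ->
  monotone_op dot A -> monotone_op dot (op_gamma gamma w A).
Proof.
move=> /andP[g0 g1] monA x y u v [a Aa <-] [b Ab <-].
have := monotone_inner monA Aa Ab; rewrite -/(inner dot _ _).
have -> : gamma^-1 *: (x - (1 - gamma) *: w)
    - gamma^-1 *: (y - (1 - gamma) *: w) = gamma^-1 *: (x - y) by rewrite -scalerBr opprB addrA subrK.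
rewrite innerZl pmulr_rge0 ?invr_gt0// => ab.
set c := gamma^-1 * (1 - gamma).
have -> : a + c *: (x - w) - (b + c *: (y - w)) = (a - b) + c *: (x - y).
  by rewrite opprD addrACA -scalerBr opprB addrA subrK.
rewrite innerDr innerZr addr_ge0// mulr_ge0 ?inner_ge0//.
by rewrite mulr_ge0 ?invr_ge0 ?subr_ge0 ?ltW.
Qed.

(** Minty's theorem for [A] supplies [p]; the point [gamma *: p + (1 - gamma) *: w] solves the
    inclusion for [op_gamma], whose monotonicity makes it the only solution. *)
Lemma resolvent_op_gamma gamma w A : 0 < gamma < 1 ->
  maximally_monotone dot A ->
  resolvent (op_gamma gamma w A) = gamma *: resolvent A + cst ((1 - gamma) *: w).
Proof.
move=> g01 maxA; have /andP[g0 _] := g01; have gn0 := lt0r_neq0 g0.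
apply/funext => z; apply: resolventE; first exact: op_gamma_monotone g01 maxA.1.
have := resolvent_graph z maxA; set p := resolvent A z => Ap.
rewrite /op_gamma /=.
rewrite -[(gamma *: resolvent A + _) z]/(gamma *: p + (1 - gamma) *: w).
exists (z - p); first by rewrite addrK scalerA mulVf// scale1r.
by apply: (inner_inj hdot) => y; rewrite !innerE; field.
Qed.

End Minty.

Theorem lemma2p2 (R : realType) (X : completeNormedModType R)
    (dot : {dot X for idfun}) (hdot : dot_induces_norm dot)
    (A B : X -> set X)
    (hA : maximally_monotone dot A) (hB : maximally_monotone dot B)
    (w : X) (gamma lambda : R)
    (hgamma : 0 < gamma < 1) (hlambda : 0 < lambda <= 1) :
  let Ag := op_gamma gamma w A in
  let Bg := op_gamma gamma w B in
  let JA := resolvent A in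
  let JB := resolvent B in
  let RA := reflected_resolvent A in
  let RB := reflected_resolvent B in
  let JAg := resolvent Ag in
  let JBg := resolvent Bg in
  let RAg := reflected_resolvent Ag in
  let RBg := reflected_resolvent Bg in
  let TAB := douglas_rachford A B in
  let TBA := douglas_rachford B A in
  let TAgBg := aragon_campoy lambda Ag Bg in
  let TBgAg := aragon_campoy lambda Bg Ag in
  [/\ [/\ RBg \o RAg = idfun + 2 *: (JBg \o RAg) - 2 *: JAg,
          RBg \o RAg = idfun + (2 * gamma) *: (JB \o RAg) - (2 * gamma) *: JA
        & RBg \o RAg = TAB + (1 - 2 * gamma) *: JA - (JB \o RA)
                       + (2 * gamma) *: (JB \o RAg)],
      [/\ RAg \o RBg = idfun + 2 *: (JAg \o RBg) - 2 *: JBg,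
          RAg \o RBg = idfun + (2 * gamma) *: (JA \o RBg) - (2 * gamma) *: JB
        & RAg \o RBg = TBA + (1 - 2 * gamma) *: JB - (JA \o RB)
                       + (2 * gamma) *: (JA \o RBg)],
      [/\ TAgBg = idfun + (2 * lambda) *: (JBg \o RAg) - (2 * lambda) *: JAg,
          TAgBg = idfun + (2 * lambda * gamma) *: (JB \o RAg)
                  - (2 * lambda * gamma) *: JA,
          TAgBg = idfun + (2 * lambda * gamma) *: ((JB \o RAg) - JA),
          TAgBg = TAB + (1 - 2 * lambda * gamma) *: JA - (JB \o RA)
                  + (2 * lambda * gamma) *: (JB \o RAg)
        & TAgBg = TBA + JB - (JA \o RB) + (2 * lambda * gamma) *: (JB \o RAg)
                  - (2 * lambda * gamma) *: JA]
    & [/\ TBgAg = idfun + (2 * lambda) *: (JAg \o RBg) - (2 * lambda) *: JBg,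
          TBgAg = idfun + (2 * lambda * gamma) *: (JA \o RBg)
                  - (2 * lambda * gamma) *: JB,
          TBgAg = idfun + (2 * lambda * gamma) *: ((JA \o RBg) - JB)
        & TBgAg = TBA + (1 - 2 * lambda * gamma) *: JB - (JA \o RB)
                  + (2 * lambda * gamma) *: (JA \o RBg)]].
Proof.
move=> /=; rewrite /douglas_rachford /aragon_campoy /reflected_resolvent.
(* Each identity becomes linear in values of [resolvent A] and [resolvent B], taken at the same
   arguments on both sides. *)
rewrite !(resolvent_op_gamma hdot w hgamma)//.
by split; split; apply/funext => x; apply: (inner_inj hdot) => z;
  rewrite !fctE !innerE; field.
Qed.
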